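(* The Weisfeiler-Leman dimension (WL-dimension) of the class of finite distance-hereditary graphs is equal to $2$. That is, the maximum of the WL-dimension of $X$, taken over all finite distance-hereditary graphs $X$, equals $2$.
   Context: Graphs are finite, simple and undirected (not necessarily connected); a graph is a pair $X=(\Omega,E)$ with $\Omega$ a finite set and $E\subseteq\Omega\times\Omega$ irreflexive and symmetric. A graph $X$ is distance-hereditary if the distance between any two vertices in any connected induced subgraph of $X$ is the same as it is in $X$. The $d$-dimensional Weisfeiler-Leman algorithm ($d$-dim WL), $d\ge 1$, is as follows. For $d=1$ (naive colour refinement): all vertices of a graph get the same initial colour, and in each round the new colour of a vertex $v$ is the pair consisting of its old colour and the multiset of old colours of its neighbours. For $d\ge 2$: the initial colour of a $d$-tuple $(v_1,\dots,v_d)\in\Omega^d$ records, for all $i,j$, whether $v_i=v_j$ and whether $(v_i,v_j)\in E$; in each round the new colour of $\bar v=(v_1,\dots,v_d)$ is the pair consisting of its old colour and the multiset, over all $w\in\Omega$, of the $d$-tuples of old colours of $\bar v[1\to w],\dots,\bar v[d\to w]$, where $\bar v[i\to w]$ is obtained from $\bar v$ by replacing its $i$-th entry by $w$. For $d=2$ this is the ordinary Weisfeiler-Leman algorithm. The $d$-dim WL distinguishes two graphs if, after some number of rounds run on both of them, the multisets of colours of all $d$-tuples (vertices, if $d=1$) in the two graphs differ. The $d$-dim WL identifies $X$ if it distinguishes $X$ from every graph not isomorphic to $X$. The WL-dimension of a graph $X$ is the smallest positive integer $d_X$ such that for every $d\ge d_X$ the $d$-dim WL identifies $X$. The WL-dimension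 of a class of graphs is the maximum WL-dimension of a graph belonging to the class. *)

(* Defs.v *)
From mathcomp Require Import all_boot.
From mathcomp Require Import finmap multiset.

Set Implicit Arguments.
Unset Strict Implicit.
Unset Printing Implicit Defensive.

Local Open Scope mset_scope.
Local Open Scope nat_scope.

Record sgraph := SGraph {
  vertex :> finType;
  edge : rel vertex;
  edge_sym : symmetric edge;
  edge_irrefl : irreflexive edge
}.

Definition isomorphic (X Y : sgraph) : Prop :=
  exists2 f : X -> Y, bijective f & forall u v, edge (f u) (f v) = edge u v.

Section InducedSubgraph.
Variables (X : sgraph) (S : {set X}).

Definition induced_edge : rel {x : X | x \in S} :=
  fun x y => edge (val x) (val y).

Lemma induced_edge_sym : symmetric induced_edge.
Proof. by move=> x y; apply: edge_sym. Qed.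

Lemma induced_edge_irrefl : irreflexive induced_edge.
Proof. by move=> x; apply: edge_irrefl. Qed.

Definition induced : sgraph := SGraph induced_edge_sym induced_edge_irrefl.

End InducedSubgraph.

Definition connected (X : sgraph) : Prop :=
  forall u v : X, connect (@edge X) u v.

Definition walk (X : sgraph) (u v : X) (n : nat) : Prop :=
  exists p : seq X, [/\ path (@edge X) u p, last u p = v & size p = n].

(* The distance as a relation: no n is related to u and v when they lie in
   different components (infinite distance). *)
Definition distance (X : sgraph) (u v : X) (n : nat) : Prop :=
  walk u v n /\ forall m, walk u v m -> n <= m.

Definition distance_hereditary (X : sgraph) : Prop :=
  forall S : {set X}, connected (induced S) ->
  forall (u v : induced S) (n : nat),
    distance u v n <-> distance (val u : X) (val v : X) n.

(* The colours after r rounds live in a type depending only on r (and d), so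
   that colours computed in different graphs can be compared. *)
Fixpoint cr_colour (r : nat) : choiceType :=
  if r is r'.+1 then (cr_colour r' * {mset cr_colour r'})%type else unit.

Fixpoint cr (X : sgraph) (r : nat) : X -> cr_colour r :=
  match r with
  | 0 => fun _ => tt
  | r'.+1 => fun v =>
      (cr r' v, seq_mset [seq cr r' w | w <- enum X & edge v w])
  end.

Definition tuple_subst (T : Type) (d : nat) (v : d.-tuple T) (i : 'I_d) (w : T)
  : d.-tuple T :=
  [tuple if j == i then w else tnth v j | j < d].

Fixpoint wl_colour (d r : nat) : choiceType :=
  if r is r'.+1 then
    (wl_colour d r' * {mset d.-tuple (wl_colour d r')})%type
  else {ffun 'I_d * 'I_d -> bool * bool}.

Fixpoint wl (X : sgraph) (d r : nat) : d.-tuple X -> wl_colour d r :=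
  match r with
  | 0 => fun v => [ffun ij => (tnth v ij.1 == tnth v ij.2,
                               edge (tnth v ij.1) (tnth v ij.2))]
  | r'.+1 => fun v =>
      (wl r' v,
       seq_mset [seq [tuple wl r' (tuple_subst v i w) | i < d] | w <- enum X])
  end.

(* The case d = 0 is never used: only positive dimensions are considered. *)
Definition distinguishes (d : nat) (X Y : sgraph) : Prop :=
  if d == 1 then
    exists r : nat, seq_mset [seq cr r v | v <- enum X]
                 <> seq_mset [seq cr r v | v <- enum Y]
  else
    exists r : nat, seq_mset [seq wl r v | v <- enum {: d.-tuple X}]
                 <> seq_mset [seq wl r v | v <- enum {: d.-tuple Y}].

Definition identifies (d : nat) (X : sgraph) : Prop :=
  forall Y : sgraph, ~ isomorphic X Y -> distinguishes d X Y.

Definition identifies_from (X : sgraph) (k : nat) : Prop :=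
  0 < k /\ forall d, k <= d -> identifies d X.

Definition WL_dimension (X : sgraph) (k : nat) : Prop :=
  identifies_from X k /\ forall m, identifies_from X m -> k <= m.

Definition class_WL_dimension (C : sgraph -> Prop) (k : nat) : Prop :=
  (forall X, C X -> exists2 n, WL_dimension X n & n <= k) /\
  (exists2 X, C X & WL_dimension X k).

(* Main.v *)
Require Import Defs.
From Stdlib Require Import Classical_Prop.
From mathcomp Require Import all_boot all_algebra.
From mathcomp Require Import finmap multiset.

Set Implicit Arguments.
Unset Strict Implicit.
Unset Printing Implicit Defensive.

Local Open Scope nat_scope.

(** Why the dimension is two.

    Lower bound: two disjoint triangles form a distance-hereditary graph, and
    colour refinement cannot tell it from the hexagon since both graphs are
    regular of degree two ([two_triangles_not_identified]).

    Upper bound: a nonempty distance-hereditary graph has a pair of twins or a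
    vertex of degree at most one (Bandelt and Mulder,
    [twins_or_degree_le1]). So it shrinks to the empty graph under two
    canonical operations: contract all twin classes at once; in a graph without
    twins, delete all vertices of degree at most one at once. Suppose that the
    pairs of vertices of [X] and [Y] carry colours that are stable under the
    two-dimensional algorithm and do not distinguish [X] from [Y]
    ([wl_equiv]). Being twins and having degree at most one are visible in the
    colours, so both operations can be carried out in [X] and [Y]
    simultaneously, and the smaller graphs inherit such colours
    ([wl_equiv_quotient], [wl_equiv_induced]). By induction the smaller graphs
    are isomorphic, by an isomorphism that respects the colours of the diagonal
    pairs. These colours record what was contracted or deleted, hence the
    isomorphism extends to [X] and [Y] ([quotient_iso_lift],
    [core_iso_lift]). The graph [Y] is arbitrary: it merely follows the
    reductions of [X].

    For [d >= 2] a stable round of the [d]-dimensional algorithm colours the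
    pair [(u, v)] by the colour of [(u, v, ..., v)], and these colours are
    stable for the two-dimensional algorithm ([wl_pairs_equiv]).

    The existence of twins or of a vertex of degree at most one is proved on the
    last level of a breadth-first search: some module of the graph with at least
    two elements is contained in a neighbourhood, or a vertex of the last level
    has degree at most one. A subset of a neighbourhood induces no path on four
    vertices, because its ends would have distance three along the path and two
    in the graph; and a module without induced paths on four vertices
    contains twins ([P4_free_twins]). *)

(** * Twins and modules *)

Section Modules.
Variable T : finType.
Implicit Types (e : rel T) (M N B : {set T}) (x y z v : T).

(** True and false twins at once: [x] and [y] form a module. *)
Definition twin e x y := [forall z, (z != x) && (z != y) ==> (e x z == e y z)].

Definition module e M :=
  forall x y z, x \in M -> y \in M -> z \notin M -> e x z = e y z.

Definition P4_free e M := forall a b c d,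
  a \in M -> b \in M -> c \in M -> d \in M ->
  e a b -> e b c -> e c d -> ~~ e a c -> ~~ e b d -> ~~ e a d -> False.

Definition compl_rel e : rel T := fun x y => (x != y) && ~~ e x y.

Lemma twinP e x y :
  reflect (forall z, z != x -> z != y -> e x z = e y z) (twin e x y).
Proof.
apply: (iffP forallP) => [H z zx zy|H z].
  by apply/eqP; move: (H z); rewrite zx zy.
by apply/implyP => /andP[zx zy]; apply/eqP/H.
Qed.

Lemma twin_refl e x : twin e x x.
Proof. exact/twinP. Qed.

Lemma twin_sym e x y : twin e x y = twin e y x.
Proof. by apply/twinP/twinP => H z zx zy; rewrite H. Qed.

(** The only delicate vertex is the middle one: whether [x] sees [y], and
    whether [z] sees [y], both amount to whether [x] sees [z]. *)
Lemma twin_trans e : symmetric e ->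
  forall x y z, twin e x y -> twin e y z -> twin e x z.
Proof.
move=> sym x y z /twinP xy /twinP yz; apply/twinP => w wx wz.
have [wy|wy] := eqVneq w y; last by rewrite xy // yz.
rewrite {w}wy in wx wz *.
have [xz|xz] := eqVneq x z; first by rewrite xz.
by rewrite sym yz // 1?(eq_sym x) // sym xy 1?(eq_sym z) // sym.
Qed.

Section Component.
Variables (e : rel T) (B : {set T}) (b : T).
Hypotheses (sym : symmetric e) (bB : b \in B).

Definition component : {set T} :=
  [set c | connect (fun x y => [&& x \in B, y \in B & e x y]) b c].

Lemma component_root : b \in component.
Proof. by rewrite inE connect0. Qed.

Lemma component_sub : component \subset B.
Proof.
apply/subsetP => x; rewrite inE => /connectP[p bp ->].
move: bB bp; elim: p (b) => //= y p IH a _ /andP[/and3P[_ yB _]]; exact: IH.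
Qed.

Lemma component_closed x y :
  x \in component -> y \in B -> e x y -> y \in component.
Proof.
move=> xN yB xy; have xB := subsetP component_sub x xN.
move: xN; rewrite !inE => bx; apply: connect_trans bx _.
by apply: connect1; rewrite xB yB.
Qed.

(** Being joined to a given outside vertex propagates along the edges of a
    component, so it is enough to compare adjacent vertices. *)
Lemma component_module :
  (forall x y z, x \in component -> y \in component -> e x y ->
     z \notin component -> e x z -> e y z) -> module e component.
Proof.
move=> H.
have step x y z : x \in component -> y \in component -> e x y ->
    z \notin component -> e x z = e y z.
  by move=> xN yN xy zN; apply/idP/idP; apply: H; rewrite // sym.
have run x z : x \in component -> z \notin component -> e x z = e b z.
  rewrite inE => /connectP[p bp ->] zN.
  suff {bp} key : forall a, a \in component ->
      path (fun x y => [&& x \in B, y \in B & e x y]) a p -> e a z = e (last a p) z.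
    by rewrite -key // component_root.
  elim: p => //= y p IH a aN /andP[/and3P[_ yB ay] yp].
  have yN := component_closed aN yB ay.
  by rewrite (step _ _ _ aN yN ay zN) IH.
by move=> x y z xN yN zN; rewrite run // run.
Qed.

End Component.

Lemma compl_rel_sym e : symmetric e -> symmetric (compl_rel e).
Proof. by move=> sym x y; rewrite /compl_rel eq_sym sym. Qed.

Lemma module_compl e M : module (compl_rel e) M -> module e M.
Proof.
move=> H x y z xM yM zM; have := H x y z xM yM zM; rewrite /compl_rel.
have -> : x != z by apply: contraNneq zM => <-.
have -> : y != z by apply: contraNneq zM => <-.
by move=> /= /negb_inj.
Qed.

Lemma compl_module e M : module e M -> module (compl_rel e) M.
Proof.
move=> H x y z xM yM zM; rewrite /compl_rel (H _ _ _ xM yM zM).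
have -> : x != z by apply: contraNneq zM => <-.
by have -> : y != z by apply: contraNneq zM => <-.
Qed.

(** The path on four vertices is its own complement. *)
Lemma compl_P4_free e M :
  symmetric e -> irreflexive e -> P4_free e M -> P4_free (compl_rel e) M.
Proof.
rewrite /compl_rel => sym irr H a b c d aM bM cM dM.
move=> /andP[ab nab] /andP[bc nbc] /andP[cd ncd].
have [ac|ac] := eqVneq a c; first by subst c; rewrite cd ncd.
have [bd|bd] := eqVneq b d; first by subst d; rewrite ab nab.
have [ad|ad] := eqVneq a d; first by subst d; rewrite (sym a c) ncd.
rewrite /= !negbK => eac ebd ead.
by apply: (H b d a c) => //; rewrite 1?(sym d a) 1?(sym b a) 1?(sym d c).
Qed.

(** If the non-neighbours of [v] in a [P4]-free module span an edge, then the
    component containing that edge is a smaller module: an edge [x y] of the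
    component and a neighbour [z] of [v] seeing only [x] would make
    [v - z - x - y] an induced path. *)
Lemma nonneighbour_module e M v b b' :
  symmetric e -> irreflexive e -> module e M -> P4_free e M ->
  v \in M -> b \in M -> b' \in M -> ~~ e v b -> ~~ e v b' -> e b b' ->
  exists N : {set T}, [/\ N \proper M, 2 <= #|N| & module e N].
Proof.
move=> sym irr mM p4 vM bM b'M vb vb' bb'.
pose B := [set x in M | (x != v) && ~~ e v x].
have bB : b \in B.
  by rewrite !inE bM vb andbT; apply: contraNneq vb' => <-.
have b'B : b' \in B.
  by rewrite !inE b'M vb' andbT; apply: contraNneq vb => <-; rewrite sym.
have NB := component_sub e bB.
have bN := component_root e B b.
have outB z : z \in B = false -> z \in M -> z != v -> e v z.
  by rewrite inE => + zM zv; rewrite zM zv /= => /negbFE.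
exists (component e B b); split.
- apply/properP; split.
    by apply: (subset_trans NB); apply/subsetP => x; rewrite inE => /andP[].
  by exists v => //; apply/negP => /(subsetP NB); rewrite !inE eqxx andbF.
- rewrite (cardsD1 b) bN (cardsD1 b') !inE.
  have -> : b' != b by apply: contraTneq bb' => ->; rewrite irr.
  by have := component_closed bB bN b'B bb'; rewrite inE => ->.
apply: component_module => // x y z xN yN xy zN xz.
have := subsetP NB x xN; rewrite inE => /and3P[xM xv vx].
have := subsetP NB y yN; rewrite inE => /and3P[yM yv vy].
have zB : z \in B = false.
  by apply: contraNF zN => zB; apply: component_closed xN zB xz.
have [zM|zM] := boolP (z \in M); last by rewrite -(mM x).
have [zv|zv] := eqVneq z v; first by rewrite -zv sym xz in vx.
have vz := outB z zB zM zv.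
apply/negPn/negP => yz.
by apply: (p4 v z x y) => //; rewrite sym.
Qed.

Lemma P4_freeS e M N : N \subset M -> P4_free e M -> P4_free e N.
Proof. by move=> /subsetP NM H a b c d /NM ? /NM ? /NM ? /NM ?; apply: H. Qed.

(** The base case of the search for twins: around a vertex [v] whose
    neighbours [A] form a clique and whose non-neighbours [B] are independent,
    [P4]-freeness makes the neighbourhoods of the vertices of [B] nested.
    Either the largest of them is all of [A], and then its owner is a false
    twin of [v], or some vertex of [A] has no neighbour in [B], and then it is
    a true twin of [v]. *)
Lemma split_twins e M v :
  symmetric e -> irreflexive e -> module e M -> P4_free e M ->
  v \in M -> 2 <= #|M| ->
  {in M &, forall b b', ~~ e v b -> ~~ e v b' -> ~~ e b b'} ->
  {in M &, forall a a', e v a -> e v a' -> a != a' -> e a a'} ->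
  exists x, [/\ x \in M, x != v & twin e v x].
Proof.
move=> sym irr mM p4 vM M2 indep clique.
have trueT a : a \in M -> e v a ->
    (forall b, b \in M -> b != v -> ~~ e v b -> ~~ e a b) -> twin e v a.
  move=> aM va noB; apply/twinP => z zv za.
  have [zM|zM] := boolP (z \in M); last by rewrite (mM v a).
  have [vz|vz] := boolP (e v z); first by rewrite clique // eq_sym.
  by rewrite (negbTE (noB _ zM zv vz)).
pose B := [set b in M | (b != v) && ~~ e v b].
pose nb b := [set a in M | e v a && e b a].
have [B0|[b0 b0B]] := set_0Vmem B.
  have [x] : exists x, x \in M :\ v.
    by apply/card_gt0P; move: M2; rewrite (cardsD1 v) vM.
  rewrite !inE => /andP[xv xM].
  have noB b : b \in M -> b != v -> e v b.
    move=> bM bv; apply/negPn/negP => vb.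
    by have := in_set0 b; rewrite -B0 !inE bM bv vb.
  exists x; split=> //; apply: trueT => // [|b bM bv]; first exact: noB.
  by rewrite noB.
have [b bB bmax] := @arg_maxnP _ b0 (mem B) (fun b => #|nb b|) b0B.
have := bB; rewrite !inE => /and3P[bM bv vb].
have [/existsP[a /and3P[aM va ba]]|full] :=
    boolP [exists a, [&& a \in M, e v a & ~~ e b a]].
  exists a; split=> //; first by apply: contraTneq va => ->; rewrite irr.
  apply: trueT => // b2 b2M b2v vb2; apply/negP => ab2.
  have b2B : b2 \in B by rewrite inE b2M b2v.
  have [a']: exists a', a' \in nb b :\: nb b2.
    apply/set0Pn; rewrite finset.setD_eq0; apply/negP => sub.
    have : nb b \proper nb b2.
      apply/properP; split=> //; exists a; first by rewrite inE aM va sym.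
      by rewrite inE (negbTE ba) !andbF.
    by move/proper_card; rewrite ltnNge; move/negP; apply; apply: bmax.
  rewrite !inE => /andP[b2a' /and3P[a'M va' ba']].
  rewrite a'M va' /= in b2a'.
  have aa' : a' != a by apply: contraNneq ba => <-.
  apply: (p4 b a' a b2) => //; first exact: clique.
    by rewrite sym.
  exact: indep.
exists b; split=> //; apply/twinP => z zv zb.
have [zM|zM] := boolP (z \in M); last by rewrite (mM v b).
have [vz|vz] := boolP (e v z).
  by move: full; rewrite negb_exists => /forallP /(_ z); rewrite zM vz negbK.
by rewrite (negbTE (indep _ _ bM zM vb vz)).
Qed.

(** Induction on the module. If the non-neighbours of a vertex [v] span an
    edge, or its neighbours a non-edge, there is a smaller module, by
    [nonneighbour_module] applied to [e] or to its complement; otherwise [v]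
    itself has a twin. *)
Lemma P4_free_twins e M :
  symmetric e -> irreflexive e -> module e M -> P4_free e M -> 2 <= #|M| ->
  exists x y, x != y /\ twin e x y.
Proof.
move=> sym irr.
have [n] := ubnP #|M|; elim: n M => // n IH M ltM mM p4 M2.
have smaller N : N \proper M -> 2 <= #|N| -> module e N ->
    exists x y, x != y /\ twin e x y.
  move=> NM N2 mN; apply: (IH N) => //.
    by apply: leq_trans (proper_card NM) _.
  by apply: P4_freeS p4; apply: proper_sub.
have [v vM] : exists v, v \in M by apply/card_gt0P; apply: leq_trans M2.
have [/existsP[b /existsP[b' /and5P[bM b'M vb vb' bb']]]|noN] :=
  boolP [exists b, exists b', [&& b \in M, b' \in M, ~~ e v b, ~~ e v b' & e b b']].
  have [N [NM N2 mN]] := nonneighbour_module sym irr mM p4 vM bM b'M vb vb' bb'.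
  exact: smaller NM N2 mN.
have [/existsP[b /existsP[b' /and5P[bM b'M vb vb' bb']]]|noC] :=
  boolP [exists b, exists b', [&& b \in M, b' \in M, e v b, e v b' & compl_rel e b b']].
  have cirr : irreflexive (compl_rel e) by move=> x; rewrite /compl_rel eqxx.
  have [||N [NM N2 mN]] := nonneighbour_module (compl_rel_sym sym) cirr
    (compl_module mM) (compl_P4_free sym irr p4) vM bM b'M _ _ bb'.
  - by rewrite /compl_rel vb andbF.
  - by rewrite /compl_rel vb' andbF.
  exact: smaller NM N2 (module_compl mN).
have [||x [xM xv vx]] := split_twins sym irr mM p4 vM M2.
- move=> b b' bM b'M vb vb'; apply: contraNN noN => bb'.
  by apply/existsP; exists b; apply/existsP; exists b'; apply/and5P.
- move=> b b' bM b'M vb vb' nbb'; apply/negPn/negP => bb'; case/negP: noC.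
  apply/existsP; exists b; apply/existsP; exists b'; apply/and5P; split=> //.
  by rewrite /compl_rel nbb'.
by exists v, x; rewrite eq_sym.
Qed.

End Modules.

(** * Distances in distance-hereditary graphs *)

(** The form in which distance-heredity is used: a walk may be shortened to
    the length of any other walk with the same ends without leaving its own
    vertex set. *)
Definition pathwise_isometric (X : sgraph) := forall (x : X) (p q : seq X),
  path (@edge X) x p -> path (@edge X) x q -> last x p = last x q ->
  exists r, [/\ path (@edge X) x r, last x r = last x p, size r <= size q &
              {subset r <= x :: p}].

Section Distances.
Variable X : sgraph.
Implicit Types (x y z u v : X) (p q : seq X).

Lemma distance_of_walk u v n : walk u v n -> exists2 m, distance u v m & m <= n.
Proof.
have walkP m : reflect (walk u v m)
    [exists p : m.-tuple X, path (@edge X) u p && (last u p == v)].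
  apply: (iffP existsP) => [[p /andP[up /eqP pv]]|[p [up pv /eqP sp]]].
    by exists p; rewrite size_tuple.
  by exists (Tuple sp); rewrite /= up pv /=.
move=> /walkP wn; have ex : exists m,
  [exists p : m.-tuple X, path (@edge X) u p && (last u p == v)] by exists n.
case: (ex_minnP ex) => m /walkP wm mmin; exists m; last exact: mmin.
by split=> // k /walkP; apply: mmin.
Qed.

Lemma path_lift (S : {set X}) (x : induced S) p :
  {subset p <= S} -> path (@edge X) (val x) p ->
  exists2 q, path (@edge (induced S)) x q & map val q = p.
Proof.
elim: p x => [|y p IH] x pS /=; first by exists [::].
have yS : y \in S by apply: pS; rewrite mem_head.
case/andP=> xy yp.
have [z zp|q q1 q2] := IH (Sub y yS : induced S) _ yp.
  by apply: pS; rewrite in_cons zp orbT.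
by exists ((Sub y yS : induced S) :: q) => /=; [rewrite q1 andbT | rewrite q2].
Qed.

Lemma path_val (S : {set X}) (x : induced S) (p : seq (induced S)) :
  path (@edge X) (val x) (map val p) = path (@edge (induced S)) x p.
Proof. by elim: p x => //= y p IH x; rewrite IH. Qed.

Lemma distance_hereditary_pathwise :
  distance_hereditary X -> pathwise_isometric X.
Proof.
move=> DH x p q xp xq pq; pose S := [set z in x :: p].
have xS : x \in S by rewrite inE mem_head.
have pS : {subset p <= S} by move=> z zp; rewrite inE in_cons zp orbT.
have fromx (v : induced S) : connect (@edge (induced S)) (Sub x xS : induced S) v.
  have [p1 [p2 [pE p1v]]] : exists p1 p2, p = p1 ++ p2 /\ last x p1 = val v.
    have : val v \in x :: p by have := valP v; rewrite inE.
    by case/splitPl=> p1 p2 E; exists p1, p2.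
  have [||r xr rp1] := @path_lift S (Sub x xS) p1.
  - by move=> z zp; apply: pS; rewrite pE mem_cat zp.
  - by move: xp; rewrite pE cat_path => /andP[].
  apply/connectP; exists r => //; apply: val_inj.
  by have := last_map val r (Sub x xS : induced S); rewrite rp1 /= p1v.
have conn : connected (induced S).
  move=> u v; apply: connect_trans (fromx v).
  by rewrite (sym_connect_sym (@edge_sym (induced S))).
have lS : last x p \in S by rewrite inE mem_last.
have [m mdist mq] := @distance_of_walk x (last x p) (size q)
  (ex_intro _ q (And3 xq (esym pq) erefl)).
pose xs : induced S := Sub x xS; pose ls : induced S := Sub (last x p) lS.
have [[r [xr rl rm]] _] := (DH S conn xs ls m).2 mdist.
exists (map val r); split.
- by have := path_val xs r; rewrite xr.
- by have := last_map val r xs; rewrite rl.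
- by rewrite size_map rm.
move=> z /mapP[w _ ->]; have := valP w; rewrite inE; exact.
Qed.

Lemma pathwise_isometric_induced (S : {set X}) :
  pathwise_isometric X -> pathwise_isometric (induced S).
Proof.
move=> H x p q xp xq pq.
have [|||r [xr rl rs rp]] := H (val x) (map val p) (map val q).
- by rewrite path_val.
- by rewrite path_val.
- by rewrite !last_map pq.
rewrite -(map_cons val) in rp; rewrite size_map in rs.
have [|r' xr' E] := path_lift _ xr.
  by move=> z /rp /mapP[w _ ->]; apply: valP.
exists r'; split=> //.
- by apply: val_inj; rewrite -!(last_map val) E.
- by rewrite -(size_map val) E.
by move=> z zr'; rewrite -(mem_map val_inj); apply: rp; rewrite -E map_f.
Qed.

End Distances.

(** * Twins or a vertex of degree at most one *)

Definition degree_le1 (G : sgraph) (x : G) :=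
  forall y z, edge x y -> edge x z -> y = z.

Section Levels.
Variables (X : sgraph) (iso : pathwise_isometric X).
Variables (u : X) (lev : X -> nat).
Local Notation e := (@edge X).
Local Notation sym := (@edge_sym X).
Local Notation irr := (@edge_irrefl X).
Hypothesis levP : forall v, connect e u v -> distance u v (lev v).
Implicit Types (x y z v w : X) (p q : seq X).

Lemma no_detour x c p : path e x p -> e x c -> e c (last x p) ->
  [\/ x = last x p, e x (last x p) | exists t, [/\ t \in p, e x t & e t (last x p)]].
Proof.
move=> xp xc cl; have [||r [xr rl rs rp]] := iso xp (q := [:: c; last x p]).
- by rewrite /= xc cl.
- by [].
case: r xr rl rs rp => [|t [|t' [|t'' r]]] //=.
- by move=> _ xl _ _; apply: Or31.
- by rewrite andbT => xt <- _ _; apply: Or32.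
case/and3P=> xt tt' _ <- _ rp; apply: Or33; exists t; split=> //.
have := rp t (mem_head _ _); rewrite in_cons => /predU1P[tx|//].
by rewrite tx irr in xt.
Qed.

(** The ends of a path [a - b - c - d] have a common neighbour outside the path,
    hence a chord or a common neighbour on it. *)
Lemma dominated_P4_free (M : {set X}) m :
  {in M, forall x, e m x} -> P4_free e M.
Proof.
move=> dom a b c d aM bM cM dM ab bc cd ac bd ad.
have [|||/= E|/= ad'|[t []]] := @no_detour a m [:: b; c; d].
- by rewrite /= ab bc cd.
- by rewrite sym dom.
- by rewrite dom.
- by rewrite E sym cd in ac.
- by rewrite ad' in ad.
by rewrite !inE => /or3P[] /eqP->; rewrite /= ?(negbTE bd) ?(negbTE ac) ?irr.
Qed.

Lemma lev_walk x p : path e u p -> last u p = x -> lev x <= size p.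
Proof.
move=> up px; have ux : connect e u x by apply/connectP; exists p.
by apply: (levP ux).2; exists p.
Qed.

Lemma connect_edge x y : connect e u x -> e x y -> connect e u y.
Proof. by move=> ux xy; apply: connect_trans ux (connect1 xy). Qed.

Lemma lev_edge x y : connect e u x -> e x y -> lev y <= (lev x).+1.
Proof.
move=> ux xy; have [[p [up pl ps]] _] := levP ux.
rewrite -ps -(size_rcons p y); apply: lev_walk; last by rewrite last_rcons.
by rewrite rcons_path up pl.
Qed.

Lemma lev_edge' x y : connect e u x -> e x y -> lev x <= (lev y).+1.
Proof. by move=> ux xy; apply: lev_edge; [apply: connect_edge xy | rewrite sym]. Qed.

Lemma lev0 x : connect e u x -> lev x = 0 -> x = u.
Proof.
move=> ux x0; have [[p [_ px ps]] _] := levP ux.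
by rewrite x0 in ps; rewrite -px (size0nil ps).
Qed.

Lemma lev_pred x k : connect e u x -> lev x = k.+1 ->
  exists z, [/\ e x z, lev z = k & connect e u z].
Proof.
move=> ux xk; have [[p [up pl ps]] _] := levP ux; rewrite xk in ps.
case/lastP: p up pl ps => // p y; rewrite rcons_path last_rcons size_rcons.
case/andP=> up zy yx [ps]; rewrite {y}yx in zy.
have uz : connect e u (last u p) by apply/connectP; exists p.
exists (last u p); split=> //; first by rewrite sym.
apply/eqP; rewrite eqn_leq -{1}ps lev_walk //=.
by have := lev_edge uz zy; rewrite xk.
Qed.

Lemma geodesic z : connect e u z ->
  exists p, [/\ path e u p, last u p = z &
    forall y, y \in u :: p -> y = z \/ lev y < lev z].
Proof.
have [n] := ubnP (lev z); elim: n z => // n IH z zn uz.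
case zk: (lev z) => [|k].
  by exists [::]; split=> // [|y]; [rewrite (lev0 uz zk) | rewrite inE (lev0 uz zk) => /eqP; left].
have [w [zw wk uw]] := lev_pred uz zk.
have [|p [up pw low]] := IH w _ uw; first by rewrite wk; rewrite zk ltnS in zn.
exists (rcons p z); split.
- by rewrite rcons_path up pw sym zw.
- by rewrite last_rcons.
move=> y; rewrite -rcons_cons mem_rcons in_cons => /predU1P[|/low]; first by left.
by rewrite wk => -[-> | /ltnW]; right; rewrite ?wk.
Qed.

(** A path that stays at level [k+1] or deeper joins vertices of level [k+1]
    with the same neighbours at level [k]: prolong it by a geodesic from the
    root to a lower neighbour [z] of its start. Inside this walk there is a
    geodesic from the root to the end of the path, and its last vertex of level
    [k] can only be [z]. *)
Lemma lower_nbr k x y z q :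
  connect e u x -> lev x = k.+1 -> lev y = k.+1 -> lev z = k -> e x z ->
  path e x q -> last x q = y -> (forall w, w \in q -> k < lev w) -> e y z.
Proof.
move=> ux xk yk zk xz xq qy deep.
have uz := connect_edge ux xz.
have uy : connect e u y by apply: connect_trans ux _; apply/connectP; exists q.
have [p [up pz low]] := geodesic uz.
have [[s [us sy ss]] _] := levP uy.
have uP : path e u (p ++ x :: q) by rewrite cat_path up /= pz sym xz.
have Py : last u (p ++ x :: q) = y by rewrite last_cat.
have [|r [ur ry rs rP]] := iso uP us; first by rewrite sy.
rewrite Py in ry; rewrite ss yk in rs.
case/lastP: r ur ry rs rP => [_ /= uy' _ _|r t].
  have : lev y <= 0 by rewrite -uy'; apply: (@lev_walk u [::]).
  by rewrite yk.
rewrite rcons_path last_rcons size_rcons ltnS => /andP[ur ty] tE rs rP.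
rewrite {t}tE in ty rP.
have ut : connect e u (last u r) by apply/connectP; exists r.
have tk : lev (last u r) = k.
  apply/eqP; rewrite eqn_leq (leq_trans (lev_walk ur erefl)) //=.
  by have := lev_edge ut ty; rewrite yk.
have : last u r \in u :: p ++ x :: q.
  have := mem_last u r; rewrite in_cons => /predU1P[->|tr]; first exact: mem_head.
  by apply: rP; rewrite mem_rcons in_cons tr orbT.
rewrite -cat_cons mem_cat => /orP[/low[tz|]|]; first by rewrite sym -tz.
  by rewrite tk zk ltnn.
rewrite in_cons => /predU1P[tx|/deep]; last by rewrite tk ltnn.
by move: xk; rewrite -tx tk => /eqP; rewrite ltn_eqF.
Qed.

(** A deepest vertex [v] is chosen with as few upper neighbours as possible.
    If [v] has a neighbour on its own level, then its component there is a
    module dominated by any upper neighbour of [v]; otherwise the neighbourhood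
    of [v] is a module dominated by [v]. In both cases the module is [P4]-free
    and, unless it has one element, contains twins. *)
Lemma twins_or_degree_le1_rooted :
  (exists x y : X, x != y /\ twin e x y) \/ exists x : X, degree_le1 x.
Proof.
have [v0 uv0 vmax] := @arg_maxnP _ u (connect e u) lev (connect0 _ _).
set k := lev v0 in vmax.
have deepest x : connect e u x -> lev x <= k by move/vmax.
case kE: k => [|k'].
  right; exists v0 => y z v0y _.
  have y0 : lev y = 0.
    by apply/eqP; rewrite -leqn0 -kE deepest // (connect_edge uv0).
  have := v0y; rewrite (lev0 uv0 kE) (lev0 (connect_edge uv0 v0y) y0).
  by rewrite irr.
pose L := [set x | connect e u x && (lev x == k)].
have v0L : v0 \in L by rewrite inE uv0 /=.
pose up x := [set z | e x z & lev z == k'].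
have [v vL vmin] := @arg_minnP _ v0 (mem L) (fun x => #|up x|) v0L.
have inL x : x \in L -> connect e u x /\ lev x = k'.+1.
  by rewrite inE kE => /andP[ux /eqP].
have [uv vk] := inL v vL.
have [m [vm mk um]] := lev_pred uv vk.
have [/existsP[w /andP[wL vw]]|noL] := boolP [exists w, (w \in L) && e v w].
  pose R := component e L v.
  have RL := component_sub e vL.
  have vR := component_root e L v.
  have outR z : lev z = k' -> z \notin R.
    move=> zk; apply: contraPN zk => /(subsetP RL) /inL[_ ->] /eqP.
    by rewrite eq_sym ltn_eqF.
  have mR : module e R.
    apply: (component_module sym vL) => x y z xR yR xy zR xz.
    have [ux xk] := inL x (subsetP RL x xR).
    have [uy yk] := inL y (subsetP RL y yR).
    have uz := connect_edge ux xz.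
    have zk : lev z = k'.
      apply/eqP; rewrite eqn_leq; apply/andP; split.
        rewrite -ltnS ltn_neqAle -kE deepest // andbT.
        apply: contra zR => zk; apply: component_closed xR _ xz => //.
        by rewrite inE uz.
      by have := lev_edge' ux xz; rewrite xk.
    apply: (@lower_nbr k' x y z [:: y]) => //=; first by rewrite xy.
    by move=> t; rewrite inE => /eqP->; rewrite yk.
  left; apply: (P4_free_twins (M := R) sym irr mR).
    apply: (@dominated_P4_free _ m) => x xR.
    by rewrite sym (mR x v) // outR.
  rewrite (cardsD1 v) vR (cardsD1 w) !inE.
  have -> : w != v by apply: contraTneq vw => ->; rewrite irr.
  by have := component_closed vL vR wL vw; rewrite inE => ->.
pose M := up v.
have inM x : (x \in M) = e v x.
  rewrite inE; apply: andb_idr => vx; have ux := connect_edge uv vx.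
  rewrite eqn_leq; apply/andP; split.
    rewrite -ltnS ltn_neqAle -kE deepest // andbT; apply: contra noL => xk.
    by apply/existsP; exists x; rewrite inE ux xk.
  by have := lev_edge' uv vx; rewrite vk.
have [M1|M2] := leqP #|M| 1.
  right; exists v => x y vx vy.
  by apply: (card_le1_eqP M1); rewrite inM.
left.
have levM x : x \in M -> [/\ e v x, connect e u x & lev x = k'].
  rewrite inM => vx; have := inM x; rewrite vx inE vx /= => /eqP.
  by split=> //; apply: connect_edge vx.
have lowM x y d : x \in M -> y \in M -> (lev d).+1 = k' -> e d x -> e d y.
  move=> /levM[vx ux xk] /levM[vy uy yk] dk dx; rewrite (sym d).
  apply: (@lower_nbr (lev d) x y d [:: v; y]); rewrite ?dk //.
  - by rewrite sym.
  - by rewrite /= (sym x) vx vy.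
  by move=> t; rewrite !inE => /orP[] /eqP->; rewrite ?vk ?yk.
have nov z : lev z < k' -> e v z = false.
  by move=> zk; apply/negbTE/negP; rewrite -inM => /levM[_ _ E]; rewrite E ltnn in zk.
apply: (P4_free_twins (M := M) sym irr) => //; last first.
  by apply: (@dominated_P4_free _ v) => x; rewrite inM.
suff half x y z : x \in M -> y \in M -> z \notin M -> e x z -> e y z.
  by move=> x y z xM yM zM; apply/idP/idP; apply: half.
move=> xM yM zM xz; have [vx ux xk] := levM x xM; have [vy uy yk] := levM y yM.
have uz := connect_edge ux xz.
have [->|zv] := eqVneq z v; first by rewrite sym.
have nvz : ~~ e v z by rewrite -inM.
case k'E : k' => [|k''].
  have E w : connect e u w -> lev w = k' -> w = u by rewrite k'E; apply: lev0.
  by rewrite (E y uy yk) -(E x ux xk).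
have [d [xd dk ud]] : exists d, [/\ e x d, lev d = k'' & connect e u d].
  by apply: lev_pred; rewrite ?xk.
have dy : e d y by apply: (lowM x); rewrite ?dk // sym.
have nvd : e v d = false by apply: nov; rewrite dk k'E.
apply/negPn/negP => nyz.
(* [x] is a common neighbour of [v] and [z]. If [z] has the level of [x] or of
   [v] there is another walk from [v] to [z] that has no short cut: it is
   [v - y - d - z] or [v - y - d - w - z] respectively, where [w] is an upper
   neighbour of [z] outside of [M], which exists by the choice of [v]. *)
have [zk|zk|zk] := ltngtP (lev z) k'.
- have zk' : (lev z).+1 = k'.
    by apply/eqP; rewrite eqn_leq zk -xk; apply: lev_edge'.
  by case/negP: nyz; rewrite sym; apply: (lowM x) => //; rewrite sym.
- have {}zk : lev z = k by apply/eqP; rewrite eqn_leq deepest // kE.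
  have zL : z \in L by rewrite inE uz zk /=.
  have [w] : exists w, w \in up z :\: M.
    apply/set0Pn; rewrite finset.setD_eq0; apply/negP => sub.
    have : up z \proper M.
      by apply/properP; split=> //; exists y => //; rewrite inE sym (negbTE nyz).
    by move/proper_card; rewrite ltnNge => /negP; apply; apply: vmin.
  rewrite inE inM => /andP[nvw]; rewrite inE => /andP[zw /eqP wk].
  have dw : e d w.
    rewrite sym; apply: (@lower_nbr k'' x w d [:: z; w]) => //.
    - by rewrite xk.
    - by rewrite wk.
    - by rewrite /= xz zw.
    by move=> t; rewrite !inE => /orP[] /eqP->; rewrite ?zk ?kE ?wk k'E.
  have [|||/= E|/= E|[t [tp vt tz]]] := @no_detour v x [:: y; d; w; z].
  - by rewrite /= vy (sym y) dy dw sym zw.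
  - by [].
  - by [].
  - by rewrite E eqxx in zv.
  - by rewrite E in nvz.
  move: tp vt tz; rewrite !inE => /or4P[] /eqP->; rewrite ?(negbTE nyz) ?nvd //.
    by rewrite (negbTE nvw).
  by rewrite (negbTE nvz).
have dz : e d z.
  rewrite sym; apply: (@lower_nbr k'' x z d [:: z]) => //.
  - by rewrite xk.
  - by rewrite zk.
  - by rewrite /= xz.
  by move=> t; rewrite !inE => /eqP->; rewrite zk k'E.
have [|||/= E|/= E|[t [tp vt tz]]] := @no_detour v x [:: y; d; z].
- by rewrite /= vy (sym y) dy dz.
- by [].
- by [].
- by rewrite E eqxx in zv.
- by rewrite E in nvz.
move: tp vt tz; rewrite !inE => /or3P[] /eqP->; rewrite ?(negbTE nyz) ?nvd //.
by rewrite (negbTE nvz).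
Qed.

End Levels.

(** The Bandelt-Mulder one-vertex reduction of distance-hereditary graphs. *)
Lemma twins_or_degree_le1 (X : sgraph) (u : X) : pathwise_isometric X ->
  (exists x y : X, x != y /\ twin (@edge X) x y) \/ exists x : X, degree_le1 x.
Proof.
move=> iso.
have [v|lev levP] := @fin_all_exists X (fun=> nat)
  (fun v n => connect (@edge X) u v -> distance u v n).
  case: (boolP (connect (@edge X) u v)) => [/connectP[p up pv]|_]; last by exists 0.
  have [|m dm _] := @distance_of_walk X u v (size p); first by exists p.
  by exists m.
exact: (twins_or_degree_le1_rooted iso levP).
Qed.

(** * Bijections from equal counts *)

Lemma card_bij (A B : finType) (f : A -> B) (P : pred A) (Q : pred B) :
  bijective f -> (forall x, Q (f x) = P x) -> #|P| = #|Q|.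
Proof.
move=> [g fK gK] fPQ; rewrite -!sum1_card [RHS](reindex f) /=; last first.
  by exists g => x _.
by apply: eq_bigl => x; rewrite -!topredE /= fPQ.
Qed.

Lemma fiber_injection (A B : finType) (K : eqType) (g : A -> K) (h : B -> K) :
  (forall k, #|[pred x | g x == k]| = #|[pred y | h y == k]|) ->
  exists2 f : A -> B, injective f & forall x, h (f x) = g x.
Proof.
move=> eqgh; pose fa k := enum [pred x | g x == k]; pose fb k := enum [pred y | h y == k].
have [x|f fP] := @fin_all_exists A (fun=> B)
    (fun x y => h y = g x /\ index y (fb (g x)) = index x (fa (g x))).
  have xa : x \in fa (g x) by rewrite mem_enum !inE.
  have ix : index x (fa (g x)) < size (fb (g x)).
    by rewrite -cardE -eqgh cardE index_mem.
  have [y0 _] : exists y0, y0 \in fb (g x).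
    by case: (fb _) ix => // y s _; exists y; rewrite mem_head.
  exists (nth y0 (fb (g x)) (index x (fa (g x)))); split.
    by have := mem_nth y0 ix; rewrite mem_enum => /eqP.
  by rewrite index_uniq // enum_uniq.
exists f => [x y fxy|x]; last by have [] := fP x.
have [hx ix] := fP x; have [hy iy] := fP y.
have gxy : g x = g y by rewrite -hx -hy fxy.
rewrite fxy gxy iy in ix.
have xa : x \in fa (g y) by rewrite mem_enum inE gxy.
have ya : y \in fa (g y) by rewrite mem_enum inE.
by rewrite -(nth_index x xa) -ix nth_index.
Qed.

Lemma fiber_bijection (A B : finType) (K : eqType) (g : A -> K) (h : B -> K) :
  (forall k, #|[pred x | g x == k]| = #|[pred y | h y == k]|) ->
  exists2 f : A -> B, bijective f & forall x, h (f x) = g x.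
Proof.
move=> eqgh; have [f finj fh] := fiber_injection eqgh.
have [f' f'inj _] := fiber_injection (fun k => esym (eqgh k)).
by exists f => //; apply: inj_card_bij finj (leq_card f' f'inj).
Qed.

(** Classes of an equivalence relation, given by a choice [r] of
    representatives, are counted by weighting every element with the inverse
    of the size of its class; hence a bijection which preserves sizes of
    classes proves equalities between numbers of classes even if it does not
    map classes to classes. *)
Lemma class_count (A : finType) (r : A -> A) (P : pred A) :
  (forall x, r (r x) = r x) -> (forall x, P (r x) = P x) ->
  (\sum_(x | P x) (#|[pred y | r y == r x]|%:R)^-1 =
   #|[pred x | (r x == x) && P x]|%:R :> rat)%R.
Proof.
move=> rr Pr.
rewrite (partition_big r (fun w => (r w == w) && P w)) /=; last first.
  by move=> x; rewrite rr eqxx Pr.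
rewrite -sum1_card GRing.natr_sum; apply: eq_bigr => w /andP[/eqP rw Pw].
rewrite (eq_big (fun x => r x == w) (fun=> (#|[pred y | r y == w]|%:R)^-1)%R).
- rewrite GRing.sumr_const.
  rewrite -[RHS](@GRing.mulfV _ (#|[pred y | r y == w]|%:R : rat)%R).
    by rewrite GRing.mulr_natl.
  rewrite Num.Theory.pnatr_eq0 -lt0n; apply/card_gt0P.
  by exists w; rewrite inE rw.
- by move=> x; apply: andb_idl => /eqP E; rewrite -Pr E.
by move=> x /andP[_ /eqP->].
Qed.

Lemma class_count_bij (A B : finType) (r : A -> A) (s : B -> B)
    (P : pred A) (Q : pred B) (f : A -> B) :
  (forall x, r (r x) = r x) -> (forall x, P (r x) = P x) ->
  (forall y, s (s y) = s y) -> (forall y, Q (s y) = Q y) ->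
  bijective f -> (forall x, Q (f x) = P x) ->
  (forall x, #|[pred y | s y == s (f x)]| = #|[pred y | r y == r x]|) ->
  #|[pred x | (r x == x) && P x]| = #|[pred y | (s y == y) && Q y]|.
Proof.
move=> rr Pr ss Qs [g fK gK] fPQ fsize; apply/eqP.
rewrite -(Num.Theory.eqr_nat rat) -!class_count //.
rewrite [X in _ == X](reindex f) /=; last by exists g => x _.
by apply/eqP/eq_big => [x|x _]; rewrite ?fPQ ?fsize.
Qed.

Lemma card_induced (X : sgraph) (S : {set X}) (P : pred X) :
  #|[pred u : induced S | P (val u)]| = #|[pred x | (x \in S) && P x]|.
Proof.
rewrite -(card_image val_inj); apply: eq_card => x; rewrite [RHS]inE /=.
apply/imageP/andP => [[u Pu ->]|[xS Px]]; first by rewrite (valP u).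
by exists (Sub x xS).
Qed.

(** * Stable colourings of pairs *)

(** [cX] and [cY] colour the pairs of vertices of two graphs compatibly with a
    run of the two-dimensional algorithm that stabilised without telling the
    graphs apart: a colour determines the multiset of the colours of the two
    other sides of the triangles above a pair. Multisets are compared by
    bijections. *)
Record wl_equiv (X Y : sgraph) (T : Type) (cX : X -> X -> T) (cY : Y -> Y -> T)
    : Prop := WLEquiv {
  wl_diag : exists2 f : X -> Y, bijective f & forall x, cX x x = cY (f x) (f x);
  wl_eq : forall u v u' v', cX u v = cY u' v' -> (u == v) = (u' == v');
  wl_edge : forall u v u' v', cX u v = cY u' v' -> edge u v = edge u' v';
  wl_triangle : forall u v u' v', cX u v = cY u' v' ->
    exists2 f : X -> Y, bijective f &
      forall w, cX u w = cY u' (f w) /\ cX w v = cY (f w) v'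
}.

Lemma wl_equiv_sym (X Y : sgraph) (T : Type) (cX : X -> X -> T) (cY : Y -> Y -> T) :
  wl_equiv cX cY -> wl_equiv cY cX.
Proof.
move=> [[f [g fK gK] fd] eqc edc tri]; split=> [|u v u' v' E|u v u' v' E|u v u' v' E].
- by exists g => [|x]; [exists f | rewrite -{1 2}(gK x) fd].
- by rewrite (eqc _ _ _ _ (esym E)).
- by rewrite (edc _ _ _ _ (esym E)).
have [h [k hK kK] hP] := tri _ _ _ _ (esym E).
by exists k => [|w]; [exists h | have [] := hP (k w); rewrite kK].
Qed.

Section Colours.
Variables (X Y : sgraph) (T : Type) (cX : X -> X -> T) (cY : Y -> Y -> T).
Hypothesis H : wl_equiv cX cY.

Lemma wl_left x y x' y' : cX x y = cY x' y' -> cX x x = cY x' x'.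
Proof.
move=> E; have [f _ fP] := wl_triangle H E.
have [E1 _] := fP x; have := wl_eq H E1.
by rewrite eqxx => /esym/eqP E2; rewrite E1 -E2.
Qed.

Lemma wl_right x y x' y' : cX x y = cY x' y' -> cX y y = cY y' y'.
Proof.
move=> E; have [f _ fP] := wl_triangle H E.
have [_ E1] := fP y; have := wl_eq H E1.
by rewrite eqxx => /esym/eqP E2; rewrite E1 E2.
Qed.

Lemma wl_card : #|X| = #|Y|.
Proof. by have [f fbij _] := wl_diag H; apply: (bij_eq_card fbij). Qed.

Lemma wl_twin_sub x y x' y' : cX x y = cY x' y' ->
  twin (@edge X) x y -> twin (@edge Y) x' y'.
Proof.
move=> E /twinP xy; have [f [g fK gK] fP] := wl_triangle H E.
apply/twinP => w wx wy; have := fP (g w); rewrite gK => -[E1 E2].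
rewrite -(wl_edge H E1) (edge_sym y') -(wl_edge H E2) xy 1?edge_sym //.
  by rewrite eq_sym (wl_eq H E1) eq_sym.
by rewrite (wl_eq H E2).
Qed.

Lemma bij_induced (S : {set X}) (S' : {set Y}) (f : X -> Y) :
  bijective f -> (forall x, (f x \in S') = (x \in S)) ->
  exists2 g : induced S -> induced S', bijective g & forall u, val (g u) = f (val u).
Proof.
move=> [h fK hK] fS.
have hS y : (h y \in S) = (y \in S') by rewrite -fS hK.
have fv (u : induced S) : f (val u) \in S' by rewrite fS (valP u).
have hv (u : induced S') : h (val u) \in S by rewrite hS (valP u).
exists (fun u => Sub (f (val u)) (fv u) : induced S') => [|u]; last exact: SubK.
exists (fun u => Sub (h (val u)) (hv u) : induced S) => u; apply: val_inj.
  exact: fK.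
exact: hK.
Qed.

(** The bijections of [wl_triangle] preserve diagonal colours, hence restrict to
    sets of vertices that the diagonal colours define. *)
Lemma wl_equiv_induced (S : {set X}) (S' : {set Y}) :
  (forall x y, cX x x = cY y y -> (x \in S) = (y \in S')) ->
  @wl_equiv (induced S) (induced S') T
    (fun u v => cX (val u) (val v)) (fun u v => cY (val u) (val v)).
Proof.
move=> SS'; split=> [|u v u' v' /(wl_eq H)|u v u' v' /(wl_edge H)|u v u' v' /(wl_triangle H)].
- have [f fbij fd] := wl_diag H.
  have [x|g gbij gf] := @bij_induced S S' f fbij; first by rewrite -(SS' x).
  by exists g => // x; rewrite gf fd.
- by rewrite !val_eqE.
- by [].
case=> f fbij fP.
have [x|g gbij gf] := @bij_induced S S' f fbij.
  by rewrite -(SS' x) //; have [_ /wl_right] := fP x; have [/wl_right] := fP x.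
by exists g => // x; rewrite gf; apply: fP.
Qed.

End Colours.

(** * Contracting twin classes *)

Section TwinClasses.
Variable X : sgraph.
Local Notation e := (@edge X).
Implicit Types x y a b : X.

Definition twin_rep x : X := odflt x [pick y | twin e x y].

Lemma twin_repP x : twin e x (twin_rep x).
Proof. by rewrite /twin_rep; case: pickP => //= _; apply: twin_refl. Qed.

Lemma twin_eq x y z : twin e x y -> twin e x z = twin e y z.
Proof.
move=> xy; apply/idP/idP; last exact: (twin_trans (@edge_sym X)).
by apply: (twin_trans (@edge_sym X)); rewrite twin_sym.
Qed.

Lemma twin_rep_eq x y : (twin_rep x == twin_rep y) = twin e x y.
Proof.
apply/eqP/idP => [E|xy].
  by rewrite (twin_eq _ (twin_repP x)) E twin_sym twin_repP.
rewrite /twin_rep (eq_pick (fun z => twin_eq z xy)).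
by case: pickP => //= /(_ y); rewrite twin_refl.
Qed.

Lemma twin_rep_idem x : twin_rep (twin_rep x) = twin_rep x.
Proof. by apply/eqP; rewrite twin_rep_eq twin_sym twin_repP. Qed.

Lemma edge_twins x y a b :
  twin e x a -> twin e y b -> ~~ twin e x y -> edge x y = edge a b.
Proof.
move=> xa yb xy.
have ya : y != a by apply: contraNneq xy => ->.
have yx : y != x by apply: contraNneq xy => ->; apply: twin_refl.
have ay : a != y by rewrite eq_sym.
have ab : a != b by apply: contraNneq xy => E; rewrite (twin_eq _ xa) E twin_sym.
by rewrite (twinP _ _ _ xa) // edge_sym (twinP _ _ _ yb) // edge_sym.
Qed.

(** A vertex cannot have both a true and a false twin. *)
Lemma edge_in_twin_class x y a b : twin e x y -> twin e a b -> twin e x a ->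
  x != y -> a != b -> edge x y = edge a b.
Proof.
move=> xy ab xa nxy nab.
have same p q r : twin e q r -> p != q -> p != r -> edge p q = edge p r.
  by move=> qr pq pr; rewrite edge_sym (twinP _ _ _ qr) // edge_sym.
have ya : twin e y a by rewrite -(twin_eq _ xy).
have yb : twin e y b by apply: (twin_trans (@edge_sym X) ya ab).
have [E|ay] := eqVneq a y.
  by subst y; rewrite edge_sym; apply: same => //; rewrite 1?eq_sym // (twin_eq _ xa).
rewrite edge_sym (@same y x a) ?[y == _]eq_sym // edge_sym.
exact: same.
Qed.

Definition twin_transversal : {set X} := [set x | twin_rep x == x].

Lemma twin_rep_transversal x : twin_rep x \in twin_transversal.
Proof. by rewrite inE twin_rep_idem. Qed.

Definition transversal_rep x : induced twin_transversal :=
  Sub (twin_rep x) (twin_rep_transversal x).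

Lemma twin_transversal_eq (u v : induced twin_transversal) :
  (u == v) = twin e (val u) (val v).
Proof.
have := valP u; have := valP v; rewrite !inE => /eqP vE /eqP uE.
by rewrite -twin_rep_eq vE uE val_eqE.
Qed.

Lemma transversal_repE (u : induced twin_transversal) x :
  (transversal_rep x == u) = twin e x (val u).
Proof.
by rewrite twin_transversal_eq SubK -(twin_eq _ (twin_repP x)).
Qed.

Lemma transversal_rep_eq x y :
  (transversal_rep x == transversal_rep y) = twin e x y.
Proof. by rewrite -val_eqE twin_rep_eq. Qed.

Section ClassColour.
Variables (T : finType) (c : X -> X -> T).

(** The colour of a pair of twin classes. Sets are enough: for stable colours,
    two such sets with a common element coincide. *)
Definition class_colour x y : {set T} :=
  [set c ab.1 ab.2 | ab in [pred ab : X * X | twin e x ab.1 && twin e y ab.2]].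

Lemma class_colourP x y t :
  reflect (exists a b, [/\ twin e x a, twin e y b & t = c a b])
          (t \in class_colour x y).
Proof.
apply: (iffP imsetP) => [[[a b] /andP[/= xa yb] ->]|[a [b [xa yb ->]]]].
  by exists a, b.
by exists (a, b); rewrite // inE /= xa yb.
Qed.

Lemma mem_class_colour x y a b : twin e x a -> twin e y b -> c a b \in class_colour x y.
Proof. by move=> xa yb; apply/class_colourP; exists a, b. Qed.

Lemma class_colour_twins x y a b :
  twin e x a -> twin e y b -> class_colour x y = class_colour a b.
Proof.
move=> xa yb; apply/setP => t.
apply/class_colourP/class_colourP => -[p [q [hp hq ->]]]; exists p, q; split=> //.
- by rewrite -(twin_eq _ xa).
- by rewrite -(twin_eq _ yb).
- by rewrite (twin_eq _ xa).
- by rewrite (twin_eq _ yb).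
Qed.

End ClassColour.
End TwinClasses.

Lemma wl_twin (X Y : sgraph) (T : Type) (cX : X -> X -> T) (cY : Y -> Y -> T)
    x y x' y' : wl_equiv cX cY -> cX x y = cY x' y' ->
  twin (@edge X) x y = twin (@edge Y) x' y'.
Proof.
move=> H E; apply/idP/idP; first exact: wl_twin_sub H _ _ _ _ E.
exact: wl_twin_sub (wl_equiv_sym H) _ _ _ _ (esym E).
Qed.

(** A colour of a pair determines the colour of the pair of twin classes: fill
    in the other vertices of the two classes one at a time by triangles. *)
Lemma class_colour_sub (X Y : sgraph) (T : finType)
    (cX : X -> X -> T) (cY : Y -> Y -> T) x y x' y' :
  wl_equiv cX cY -> cX x y = cY x' y' ->
  class_colour cX x y \subset class_colour cY x' y'.
Proof.
move=> H E; apply/subsetP => t /class_colourP[a [b [xa yb ->]]].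
have [f _ fP] := wl_triangle H E; have [E1 E2] := fP b.
have [g _ gP] := wl_triangle H E1; have [E3 E4] := gP a.
rewrite E4; apply: mem_class_colour.
  by rewrite -(wl_twin H E3).
by rewrite twin_sym -(wl_twin H E2) twin_sym.
Qed.

Section Quotient.
Variables (X Y : sgraph) (T : finType) (cX : X -> X -> T) (cY : Y -> Y -> T).
Hypothesis H : wl_equiv cX cY.

Lemma class_colour_eq x y (x' y' : Y) : cX x y = cY x' y' ->
  class_colour cX x y = class_colour cY x' y'.
Proof.
move=> E; apply/eqP; rewrite eqEsubset (class_colour_sub H E).
exact: (class_colour_sub (wl_equiv_sym H) (esym E)).
Qed.

Lemma class_colour_inv x y (x' y' : Y) :
  class_colour cX x y = class_colour cY x' y' ->
  exists a b a' b', [/\ twin (@edge X) x a, twin (@edge X) y b,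
    twin (@edge Y) x' a', twin (@edge Y) y' b' & cX a b = cY a' b'].
Proof.
move=> E; have := mem_class_colour cX (twin_refl _ x) (twin_refl _ y).
rewrite E => /class_colourP[a' [b' [xa' yb' E']]].
by exists x, y, a', b'; split=> //; apply: twin_refl.
Qed.

Lemma twin_class_card x (x' : Y) : cX x x = cY x' x' ->
  #|[pred y | twin_rep y == twin_rep x]| = #|[pred y | twin_rep y == twin_rep x']|.
Proof.
move=> E; have [f fbij fP] := wl_triangle H E.
apply: (card_bij fbij) => y; have [_ /wl_twin tw] := fP y.
by rewrite /= !twin_rep_eq tw.
Qed.

Local Notation SX := (twin_transversal X).
Local Notation SY := (twin_transversal Y).

(** Matching twin classes: the class colours seen from the representatives
    occur equally often in both quotients, since they occur equally often,
    each weighted by the size of the class, in the graphs themselves. *)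
Lemma quotient_fibers (K : eqType) (g : X -> K) (h : Y -> K) (f : X -> Y) :
  bijective f -> (forall x, h (f x) = g x) -> (forall x, cX x x = cY (f x) (f x)) ->
  (forall x, g (twin_rep x) = g x) -> (forall y, h (twin_rep y) = h y) ->
  exists2 F : induced SX -> induced SY, bijective F &
    forall u, h (val (F u)) = g (val u).
Proof.
move=> fbij fgh fd gr hr.
apply: (@fiber_bijection (induced SX) (induced SY) K (g \o val) (h \o val)) => k /=.
rewrite (card_induced SX (fun x => g x == k)) (card_induced SY (fun x => h x == k)).
rewrite (eq_card (B := [pred x | (twin_rep x == x) && (g x == k)])); last first.
  by move=> x; rewrite !inE.
rewrite [RHS](eq_card (B := [pred x | (twin_rep x == x) && (h x == k)])); last first.
  by move=> x; rewrite !inE.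
apply: (class_count_bij (f := f)) => //=.
- exact: twin_rep_idem.
- by move=> x; rewrite gr.
- exact: twin_rep_idem.
- by move=> x; rewrite hr.
- by move=> x; rewrite fgh.
by move=> x; rewrite (twin_class_card (fd x)).
Qed.

Lemma wl_equiv_quotient :
  @wl_equiv (induced SX) (induced SY) {set T}
    (fun u v => class_colour cX (val u) (val v))
    (fun u v => class_colour cY (val u) (val v)).
Proof.
have rr (Z : sgraph) (c : Z -> Z -> T) x y :
    class_colour c (twin_rep x) y = class_colour c x y.
  by apply: class_colour_twins; [rewrite twin_sym twin_repP | apply: twin_refl].
have rl (Z : sgraph) (c : Z -> Z -> T) x y :
    class_colour c x (twin_rep y) = class_colour c x y.
  by apply: class_colour_twins; [apply: twin_refl | rewrite twin_sym twin_repP].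
split=> [|u v u' v' /class_colour_inv|u v u' v' /class_colour_inv|u v u' v' /class_colour_inv].
- have [f fbij fd] := wl_diag H.
  have [x|x|y|F Fbij FP] := @quotient_fibers _ (fun x => class_colour cX x x)
    (fun y => class_colour cY y y) f fbij _ fd.
  + by rewrite (class_colour_eq (fd x)).
  + by rewrite rr rl.
  + by rewrite rr rl.
  by exists F => // u; rewrite FP.
- case=> a [b [a' [b' [ua vb ua' vb' E]]]].
  by rewrite !twin_transversal_eq (twin_eq _ ua) (twin_eq _ ua') twin_sym (twin_eq _ vb)
    [RHS]twin_sym (twin_eq _ vb') twin_sym (wl_twin H E) twin_sym.
- case=> a [b [a' [b' [ua vb ua' vb' E]]]].
  have tw : twin (@edge X) (val u) (val v) = twin (@edge Y) (val u') (val v').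
    by rewrite (twin_eq _ ua) (twin_eq _ ua') twin_sym (twin_eq _ vb)
      [RHS]twin_sym (twin_eq _ vb') twin_sym (wl_twin H E) twin_sym.
  have [uv|uv] := boolP (twin (@edge X) (val u) (val v)).
    have /eqP-> : u == v by rewrite twin_transversal_eq.
    have /eqP-> : u' == v' by rewrite twin_transversal_eq -tw.
    by rewrite !edge_irrefl.
  rewrite [LHS](edge_twins ua vb uv) [RHS](edge_twins ua' vb') -?tw //.
  exact: (wl_edge H).
case=> a [b [a' [b' [ua vb ua' vb' E]]]]; have [f fbij fP] := wl_triangle H E.
have [x|x|x|y|F Fbij FP] := @quotient_fibers _
  (fun x => (class_colour cX (val u) x, class_colour cX x (val v)))
  (fun y => (class_colour cY (val u') y, class_colour cY y (val v'))) f fbij.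
- have [E1 E2] := fP x.
  rewrite (class_colour_twins cX ua (twin_refl _ x)).
  rewrite (class_colour_twins cX (twin_refl _ x) vb).
  rewrite (class_colour_twins cY ua' (twin_refl _ (f x))).
  rewrite (class_colour_twins cY (twin_refl _ (f x)) vb').
  by rewrite (class_colour_eq E1) (class_colour_eq E2).
- by have [_ /(wl_left H)] := fP x.
- by rewrite rr rl.
- by rewrite rr rl.
by exists F => // w; have [-> ->] := FP w.
Qed.

(** Inside a twin class every bijection preserves edges, so an isomorphism of
    the quotients lifts as soon as corresponding classes contain every
    diagonal colour equally often. This is so because a triangle bijection above
    a pair of twins maps the twin class onto the corresponding one. *)
Lemma quotient_iso_lift (f : induced SX -> induced SY) :
  bijective f -> (forall u v, edge (f u) (f v) = edge u v) ->
  (forall u, class_colour cX (val u) (val u) =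
             class_colour cY (val (f u)) (val (f u))) ->
  exists2 g : X -> Y, bijective g &
    (forall x y, edge (g x) (g y) = edge x y) /\ (forall x, cX x x = cY (g x) (g x)).
Proof.
move=> [f' fK f'K] fe fc.
have [s|g gbij gP] := @fiber_bijection X Y (induced SY * T)%type
  (fun x => (f (transversal_rep x), cX x x)) (fun y => (transversal_rep y, cY y y)).
  case: s => s' t; pose s := f' s'; have fs : f s = s' by apply: f'K.
  have [a [b [a' [b' [sa sb s'a s'b E]]]]] := class_colour_inv (fc s).
  rewrite fs in s'a s'b; have [F Fbij FP] := wl_triangle H E.
  apply: (card_bij Fbij) => x; have [_ E2] := FP x.
  rewrite /= !xpair_eqE -(wl_left H E2); congr (_ && _).
  have -> : (f (transversal_rep x) == s') = (transversal_rep x == s).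
    by rewrite -fs (can_eq fK).
  rewrite !transversal_repE twin_sym (twin_eq _ s'b) [RHS]twin_sym (twin_eq _ sb).
  by rewrite twin_sym -(wl_twin H E2) twin_sym.
have gc x : cX x x = cY (g x) (g x) by case: (gP x).
have gr x : transversal_rep (g x) = f (transversal_rep x) by case: (gP x).
exists g => //; split=> // x y.
have repP (Z : sgraph) (z : Z) : twin (@edge Z) z (val (transversal_rep z)).
  exact: twin_repP.
have tw : twin (@edge Y) (g x) (g y) = twin (@edge X) x y.
  by rewrite -!transversal_rep_eq !gr (can_eq fK).
have [xy|xy] := boolP (twin (@edge X) x y); last first.
  rewrite (edge_twins (repP _ (g x)) (repP _ (g y))) ?tw // !gr.
  by rewrite (edge_twins (repP _ x) (repP _ y)) //; exact: fe.
have [->|nxy] := eqVneq x y; first by rewrite !edge_irrefl.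
pose s := transversal_rep x.
have sx : twin (@edge X) (val s) x by rewrite twin_sym repP.
have sy : twin (@edge X) (val s) y by rewrite (twin_eq _ sx).
have := mem_class_colour cX sx sy; rewrite fc => /class_colourP[a [b [sa sb E]]].
rewrite (wl_edge H E); apply: edge_in_twin_class.
- by rewrite tw.
- by rewrite -(twin_eq _ sa).
- by rewrite (twin_eq _ (repP _ (g x))) gr.
- by rewrite (inj_eq (bij_inj gbij)).
by rewrite -(wl_eq H E).
Qed.

End Quotient.

(** * Deleting vertices of degree at most one *)

Section SmallDegree.
Variable X : sgraph.
Local Notation e := (@edge X).
Implicit Types x y z : X.

Definition core : {set X} :=
  [set x | [exists y, [exists z, [&& e x y, e x z & y != z]]]].

Lemma core_degree x y z : x \notin core -> e x y -> e x z -> y = z.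
Proof.
rewrite inE => xS xy xz; apply/eqP; apply: contraNT xS => yz.
by apply/existsP; exists y; apply/existsP; exists z; rewrite xy xz.
Qed.

Lemma degree_le1_core x : degree_le1 x -> x \notin core.
Proof.
move=> x1; rewrite inE; apply/existsP => -[y /existsP[z /and3P[xy xz]]].
by rewrite (x1 y z) ?eqxx.
Qed.

Hypothesis twin_free : forall x y, twin e x y -> x = y.

(** Two adjacent vertices of degree one would be twins. *)
Lemma core_cover x y : x \notin core -> e x y -> y \in core.
Proof.
move=> xS xy; apply/negPn/negP => yS.
suff E : x = y by rewrite E edge_irrefl in xy.
apply: twin_free; apply/twinP => z zx zy; apply/idP/idP => [xz|yz].
  by rewrite (core_degree xS xz xy) eqxx in zy.
by rewrite (core_degree yS yz (_ : e y x)) ?eqxx // edge_sym in zx.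
Qed.

End SmallDegree.

Lemma wl_core_sub (X Y : sgraph) (T : Type) (cX : X -> X -> T) (cY : Y -> Y -> T)
    x x' : wl_equiv cX cY -> cX x x = cY x' x' -> x \in core X -> x' \in core Y.
Proof.
move=> H E; rewrite inE => /existsP[y /existsP[z /and3P[xy xz yz]]].
have [f fbij fP] := wl_triangle H E.
rewrite inE; apply/existsP; exists (f y); apply/existsP; exists (f z).
rewrite -(wl_edge H (fP y).1) -(wl_edge H (fP z).1) xy xz /=.
by rewrite (inj_eq (bij_inj fbij)).
Qed.

Section CoreLift.
Variables (X Y : sgraph) (T : finType) (cX : X -> X -> T) (cY : Y -> Y -> T).
Hypothesis H : wl_equiv cX cY.

Lemma wl_core x x' : cX x x = cY x' x' -> (x \in core X) = (x' \in core Y).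
Proof.
move=> E; apply/idP/idP; first exact: (wl_core_sub H).
exact: (wl_core_sub (wl_equiv_sym H) (esym E)).
Qed.

Hypothesis twin_free : forall x y : X, twin (@edge X) x y -> x = y.

Lemma core_image_cover (x : X) (x' y' : Y) : cX x x = cY x' x' ->
  x \notin core X -> edge x' y' -> y' \in core Y.
Proof.
move=> E xS xy'; have [f [g fK gK] fP] := wl_triangle H E.
have := fP (g y'); rewrite gK => -[E1 _].
rewrite -(wl_core (wl_right H E1)); apply: (core_cover twin_free xS).
by rewrite (wl_edge H E1).
Qed.

(** The diagonal colour of a vertex records the colours of its neighbours of
    degree one, so an isomorphism of the cores tells where these have to go;
    a vertex without neighbours follows the bijection of the diagonal colours.
    Since there are no twins, the result is injective and no edge joins two
    deleted vertices. *)
Lemma core_iso_lift (h : induced (core X) -> induced (core Y)) :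
  bijective h -> (forall u v, edge (h u) (h v) = edge u v) ->
  (forall u, cX (val u) (val u) = cY (val (h u)) (val (h u))) ->
  exists2 g : X -> Y, bijective g &
    (forall x y, edge (g x) (g y) = edge x y) /\ (forall x, cX x x = cY (g x) (g x)).
Proof.
move=> hbij he hc; have hinj := bij_inj hbij.
have [f0 f0bij f0c] := wl_diag H.
have heY u v : edge (val (h u)) (val (h v)) = edge (val u) (val v) by exact: he.
have [x|g gP] := @fin_all_exists X (fun=> Y) (fun x y => [/\ cX x x = cY y y,
    forall n : induced (core X), edge (val (h n)) y = edge (val n) x &
    forall s : induced (core X), val s = x -> y = val (h s)]).
  have [xS|xS] := boolP (x \in core X).
    pose s : induced (core X) := Sub x xS.
    exists (val (h s)); split=> [|n|t tx]; first exact: (hc s).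
      by rewrite heY.
    by congr (val (h _)); apply: val_inj; rewrite tx.
  have noS y (s : induced (core X)) : val s = x -> y = val (h s).
    by move=> sx; rewrite -sx (valP s) in xS.
  have [/existsP[n nx]|non] := boolP [exists n : induced (core X), edge (val n) x].
    have [f fbij fP] := wl_triangle H (hc n); have [E _] := fP x.
    have yc := wl_right H E.
    have yS : f x \notin core Y by rewrite -(wl_core yc).
    have ny : edge (val (h n)) (f x) by rewrite -(wl_edge H E).
    exists (f x); split=> [//|m|]; last exact: noS.
    have [->|nm] := eqVneq m n; first by rewrite ny nx.
    have -> : edge (val m) x = false.
      apply: contraNF nm => mx; rewrite -val_eqE; apply/eqP.
      by apply: (core_degree xS); rewrite edge_sym.
    apply: contraNF nm => my; rewrite -(inj_eq hinj) -val_eqE; apply/eqP.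
    by apply: (core_degree yS); rewrite edge_sym.
  exists (f0 x); split=> [//|n|]; last exact: noS.
  have noX z : edge x z = false.
    apply/negP => xz; have zS := core_cover twin_free xS xz.
    case/existsP: non; exists (Sub z zS : induced (core X)).
    by rewrite SubK edge_sym.
  have [f [k fK kK] fP] := wl_triangle H (f0c x).
  have [E _] := fP (k (val (h n))); rewrite kK in E.
  by rewrite edge_sym -(wl_edge H E) noX edge_sym noX.
have gc x : cX x x = cY (g x) (g x) by case: (gP x).
have gn x n : edge (val (h n)) (g x) = edge (val n) x by case: (gP x).
have gs x (xS : x \in core X) : g x = val (h (Sub x xS : induced (core X))).
  by have [_ _] := gP x; apply.
have ge x y : x \in core X -> edge (g x) (g y) = edge x y.
  by move=> xS; rewrite (gs x xS) gn.
have ginj : injective g.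
  move=> x y gxy; have xyS : (x \in core X) = (y \in core X).
    by rewrite (wl_core (gc x)) (wl_core (gc y)) gxy.
  have [xS|xS] := boolP (x \in core X).
    have yS : y \in core X by rewrite -xyS.
    by have := gxy; rewrite (gs x xS) (gs y yS) => /val_inj/hinj/(congr1 val).
  have yS : y \notin core X by rewrite -xyS.
  apply: twin_free; apply/twinP => z _ _.
  have [zS|zS] := boolP (z \in core X).
    by rewrite edge_sym -(ge z x) // gxy ge // edge_sym.
  have noz w : w \notin core X -> edge w z = false.
    by move=> wS; apply/negP => /(core_cover twin_free wS); apply/negP.
  by rewrite !noz.
exists g; first by apply: inj_card_bij ginj _; rewrite -(wl_card H).
split=> // x y.
have [xS|xS] := boolP (x \in core X); first exact: ge.
have [yS|yS] := boolP (y \in core X); first by rewrite edge_sym ge // edge_sym.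
have -> : edge x y = false.
  by apply/negP => /(core_cover twin_free xS); apply/negP.
apply/negP => /(core_image_cover (gc x) xS).
by rewrite -(wl_core (gc y)); apply/negP.
Qed.

End CoreLift.

(** * Distance-hereditary graphs are determined by stable colourings *)

Lemma card_induced_lt (X : sgraph) (S : {set X}) x : x \notin S -> #|induced S| < #|X|.
Proof.
move=> xS; rewrite card_sig -cardsT; apply: proper_card.
by apply/properP; split; [apply/subsetP | exists x].
Qed.

(** Distance-hereditary graphs reduce to the empty graph by contracting all
    twin classes at once and deleting all vertices of degree at most one at
    once. Both operations are canonical, hence stable colourings pass to the
    smaller graphs; the diagonal colours keep track of what was removed. *)
Theorem wl_equiv_iso (X Y : sgraph) (T : finType) (cX : X -> X -> T) (cY : Y -> Y -> T) :
  pathwise_isometric X -> wl_equiv cX cY ->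
  exists2 g : X -> Y, bijective g &
    (forall x y, edge (g x) (g y) = edge x y) /\ (forall x, cX x x = cY (g x) (g x)).
Proof.
have [n] := ubnP #|X|; elim: n X Y T cX cY => // n IH X Y T cX cY ltX iso H.
have [u _|X0] := pickP (fun _ : X => true); last first.
  have [f0 f0bij f0c] := wl_diag H.
  by exists f0 => //; split=> // x; have := X0 x.
have smaller (S : {set X}) x : x \notin S -> #|induced S| < n.
  by move=> /card_induced_lt ltS; apply: leq_trans ltS _.
have [/existsP[x /existsP[y /andP[nxy xy]]]|notw] :=
    boolP [exists x : X, exists y : X, (x != y) && twin (@edge X) x y].
  have [z zS] : exists z, z \notin twin_transversal X.
    have [xS|] := boolP (x \in twin_transversal X); last by exists x.
    have [yS|] := boolP (y \in twin_transversal X); last by exists y.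
    move: xS yS; rewrite !inE => /eqP Ex /eqP Ey.
    by move: nxy; rewrite -Ex -Ey twin_rep_eq xy.
  have [f fbij [fe fc]] := IH _ _ _ _ _ (smaller _ _ zS)
    (pathwise_isometric_induced iso) (wl_equiv_quotient H).
  exact: (quotient_iso_lift H fbij fe fc).
have twin_free (x y : X) : twin (@edge X) x y -> x = y.
  move=> xy; apply/eqP; apply: contraNT notw => nxy.
  by apply/existsP; exists x; apply/existsP; exists y; rewrite nxy.
have [[x [y [nxy /twin_free E]]]|[x /degree_le1_core xS]] := twins_or_degree_le1 u iso.
  by rewrite E eqxx in nxy.
have [f fbij [fe fc]] := IH _ _ _ _ _ (smaller _ _ xS)
  (pathwise_isometric_induced iso) (wl_equiv_induced H (wl_core H)).
exact: (core_iso_lift H twin_free fbij fe fc).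
Qed.

(** * From tuple colours to pair colours *)

Lemma wl_equiv_fin (X Y : sgraph) (T : choiceType)
    (cX : X -> X -> T) (cY : Y -> Y -> T) : wl_equiv cX cY ->
  exists (T' : finType) (cX' : X -> X -> T') (cY' : Y -> Y -> T'), wl_equiv cX' cY'.
Proof.
move=> H.
pose s := [seq cX p.1 p.2 | p : X * X] ++ [seq cY p.1 p.2 | p : Y * Y].
have sX u v : cX u v \in s.
  by rewrite mem_cat (map_f (fun p : X * X => cX p.1 p.2) (mem_enum _ (u, v))).
have sY u v : cY u v \in s.
  by rewrite mem_cat orbC (map_f (fun p : Y * Y => cY p.1 p.2) (mem_enum _ (u, v))).
pose cX' u v := SeqSub (sX u v); pose cY' u v := SeqSub (sY u v).
have down u v u' v' : cX' u v = cY' u' v' -> cX u v = cY u' v' by case.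
have lift u v u' v' : cX u v = cY u' v' -> cX' u v = cY' u' v'.
  by move=> E; apply: val_inj.
exists (seq_sub s), cX', cY'; split=> [|u v u' v' /down|u v u' v' /down|u v u' v' /down].
- by have [f fbij fP] := wl_diag H; exists f => // x; apply: lift.
- exact: wl_eq.
- exact: wl_edge.
move=> /(wl_triangle H)[f fbij fP]; exists f => // w.
by have [? ?] := fP w; split; apply: lift.
Qed.

Lemma perm_map_bijection (A B : finType) (K : eqType) (g : A -> K) (h : B -> K) :
  perm_eq [seq g x | x <- enum A] [seq h y | y <- enum B] ->
  exists2 f : A -> B, bijective f & forall x, h (f x) = g x.
Proof.
move=> /permP gh; apply: fiber_bijection => k.
have cnt (C : finType) (q : C -> K) :
    count (pred1 k) [seq q x | x <- enum C] = #|[pred x | q x == k]|.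
  by rewrite count_map -sum1_count -sum1_card big_enum_cond; apply: eq_bigl => x.
by rewrite -!cnt gh.
Qed.

Section TupleColours.
Variables (X Y : sgraph) (d : nat).

Lemma wl_pred r (t : d.-tuple X) (t' : d.-tuple Y) : wl r.+1 t = wl r.+1 t' -> wl r t = wl r t'.
Proof. by case. Qed.

Lemma wl_initial r (t : d.-tuple X) (t' : d.-tuple Y) i j : wl r t = wl r t' ->
  (tnth t i == tnth t j) = (tnth t' i == tnth t' j) /\
  edge (tnth t i) (tnth t j) = edge (tnth t' i) (tnth t' j).
Proof.
elim: r => [|r IH] => [|/wl_pred]; last exact: IH.
by move=> /ffunP/(_ (i, j)); rewrite !ffunE => -[-> ->].
Qed.

Lemma wl_step r (t : d.-tuple X) (t' : d.-tuple Y) : wl r.+1 t = wl r.+1 t' ->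
  exists2 f : X -> Y, bijective f &
    forall i w, wl r (tuple_subst t i w) = wl r (tuple_subst t' i (f w)).
Proof.
case=> _ /eq_seq_msetP /perm_map_bijection[f fbij fP]; exists f => // i w.
by have /(congr1 (fun c => tnth c i)) := fP w; rewrite !tnth_mktuple.
Qed.

(** The number of pairs of tuples of the two graphs with equal colours cannot
    decrease for ever. *)
Lemma stable_round : exists r, forall (t : d.-tuple X) (t' : d.-tuple Y),
  wl r t = wl r t' -> wl r.+1 t = wl r.+1 t'.
Proof.
pose a r := #|[pred p : d.-tuple X * d.-tuple Y | wl r p.1 == wl r p.2]|.
suff ex (s : nat) : exists r, a r <= a r.+1.
  have [s as_] := ex 0; exists s => t t' E.
  have sub : [pred p : d.-tuple X * d.-tuple Y | wl s.+1 p.1 == wl s.+1 p.2]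
     \subset [pred p | wl s p.1 == wl s p.2].
    by apply/subsetP => p; rewrite !inE => /eqP/wl_pred/eqP.
  have same_card : a s.+1 = a s.
    by apply/eqP; rewrite eqn_leq as_ subset_leq_card.
  have := subset_cardP same_card sub (t, t').
  by rewrite !inE E eqxx => /eqP.
have [n] := ubnP (a s); elim: n s => // n IH r an.
have [le|lt] := leqP (a r) (a r.+1); first by exists r.
by apply: (IH r.+1); apply: leq_trans lt _.
Qed.

Section Stable.
Variable r : nat.
Hypothesis stable : forall (t : d.-tuple X) (t' : d.-tuple Y),
  wl r t = wl r t' -> wl r.+1 t = wl r.+1 t'.

(** Entries of a tuple may be copied to other places: a substituted entry that
    equals another entry is recognised by the initial colour. *)
Lemma wl_copy (t : d.-tuple X) (t' : d.-tuple Y) i j : i != j -> wl r t = wl r t' ->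
  wl r (tuple_subst t i (tnth t j)) = wl r (tuple_subst t' i (tnth t' j)).
Proof.
move=> ij /stable/wl_step[f _ fP]; have E := fP i (tnth t j).
have [+ _] := wl_initial i j E.
rewrite !tnth_mktuple eqxx (eq_sym j) (negbTE ij) eqxx => /esym/eqP E2.
by rewrite E E2.
Qed.

End Stable.
End TupleColours.

Section PairTuples.
Variables (k : nat).

Definition pair_tuple (A : Type) (u v : A) : k.+2.-tuple A :=
  [tuple if j == ord0 then u else v | j < k.+2].

(** Intermediate stages between [(u, w, v, ..., v)], which one substitution
    makes out of [(u, v, ..., v)], and [(u, w, ..., w)]. *)
Definition mixed_tuple (A : Type) (u w v : A) (m : nat) : k.+2.-tuple A :=
  [tuple if j == ord0 then u else if j <= m then w else v | j < k.+2].

Variables (X Y : sgraph) (r : nat).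
Hypothesis stable : forall (t : k.+2.-tuple X) (t' : k.+2.-tuple Y),
  wl r t = wl r t' -> wl r.+1 t = wl r.+1 t'.
Hypothesis same :
  perm_eq [seq wl r t | t <- enum {: k.+2.-tuple X}]
          [seq wl r t | t <- enum {: k.+2.-tuple Y}].

Let i1 : 'I_k.+2 := Ordinal (isT : 1 < k.+2).

Lemma subst_pair_left (A : Type) (u v w : A) :
  tuple_subst (pair_tuple u v) ord0 w = pair_tuple w v.
Proof. by apply: eq_from_tnth => j; rewrite !tnth_mktuple; case: eqP. Qed.

Lemma subst_pair_right (A : Type) (u v w : A) :
  tuple_subst (pair_tuple u v) i1 w = mixed_tuple u w v 1.
Proof.
apply: eq_from_tnth => j; rewrite !tnth_mktuple -!val_eqE /=.
by case: (val j) => [|[|m]].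
Qed.

Lemma mixed_step (A : Type) (u v w : A) m (mk : m.+1 < k.+2) : 0 < m ->
  tuple_subst (mixed_tuple u w v m) (Ordinal mk) (tnth (mixed_tuple u w v m) i1)
    = mixed_tuple u w v m.+1.
Proof.
move=> m0; apply: eq_from_tnth => j; rewrite !tnth_mktuple -!val_eqE /= m0.
by rewrite [in RHS]leq_eqVlt ltnS; case: eqP => [->|].
Qed.

Lemma mixed_full (A : Type) (u v w : A) : mixed_tuple u w v k.+1 = pair_tuple u w.
Proof.
by apply: eq_from_tnth => j; rewrite !tnth_mktuple -ltnS ltn_ord.
Qed.

Lemma wl_mixed (u v w : X) (u' v' w' : Y) :
  wl r (mixed_tuple u w v 1) = wl r (mixed_tuple u' w' v' 1) ->
  wl r (pair_tuple u w) = wl r (pair_tuple u' w').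
Proof.
move=> E; rewrite -(mixed_full u v w) -(mixed_full u' v' w').
suff : forall m, m < k.+1 -> wl r (mixed_tuple u w v m.+1) = wl r (mixed_tuple u' w' v' m.+1).
  by apply.
elim=> // m IH mk; rewrite -!(mixed_step _ _ _ (mk : m.+2 < k.+2)) //.
by apply: (wl_copy stable); [rewrite -val_eqE | apply: IH; apply: ltnW].
Qed.

Lemma wl_pairs_equiv :
  wl_equiv (fun u v : X => wl r (pair_tuple u v)) (fun u v : Y => wl r (pair_tuple u v)).
Proof.
have t0 (A : Type) (u v : A) : tnth (pair_tuple u v) ord0 = u by rewrite tnth_mktuple.
have t1 (A : Type) (u v : A) : tnth (pair_tuple u v) i1 = v by rewrite tnth_mktuple.
split=> [|u v u' v' E|u v u' v' E|u v u' v' /stable/wl_step[f fbij fP]].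
- have [f fbij fP] := perm_map_bijection same.
  have fc x : f (pair_tuple x x) = pair_tuple (tnth (f (pair_tuple x x)) ord0)
                                              (tnth (f (pair_tuple x x)) ord0).
    apply: eq_from_tnth => j; rewrite [RHS]tnth_mktuple if_same.
    have [+ _] := wl_initial j ord0 (fP (pair_tuple x x)).
    by rewrite [in RHS]tnth_mktuple t0 if_same eqxx => /eqP.
  exists (fun x => tnth (f (pair_tuple x x)) ord0) => [|x]; last by rewrite -fc fP.
  apply: inj_card_bij => [x y E|].
    have : f (pair_tuple x x) = f (pair_tuple y y) by rewrite fc E -fc.
    by move/(bij_inj fbij)/(congr1 (fun t => tnth t ord0)); rewrite !t0.
  have := bij_eq_card fbij; rewrite !card_tuple => /eqP.
  by rewrite eqn_exp2r // => /eqP->.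
- by have [+ _] := wl_initial ord0 i1 E; rewrite !t0 !t1.
- by have [_] := wl_initial ord0 i1 E; rewrite !t0 !t1.
exists f => // w; split; last by have := fP ord0 w; rewrite !subst_pair_left.
by apply: (wl_mixed (v := v) (v' := v')); rewrite -!subst_pair_right.
Qed.

End PairTuples.

Lemma distance_hereditary_identified (X : sgraph) d :
  distance_hereditary X -> 2 <= d -> identifies d X.
Proof.
move=> /distance_hereditary_pathwise iso; case: d => [|[|k]] // _ Y nXY.
rewrite /distinguishes /=; have [r stable] := stable_round X Y k.+2.
exists r => /eq_seq_msetP same; apply: nXY.
have [T [cX [cY H]]] := wl_equiv_fin (wl_pairs_equiv stable same).
by have [g gbij [ge _]] := wl_equiv_iso iso H; exists g.
Qed.

(** * The lower bound *)

Definition two_triangles_rel : rel 'I_6 := fun i j => (i != j) && (odd i == odd j).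
Definition hexagon_rel : rel 'I_6 :=
  fun i j => (i.+1 == j %[mod 6]) || (j.+1 == i %[mod 6]).

Fact two_triangles_sym : symmetric two_triangles_rel.
Proof. by move=> i j; rewrite /two_triangles_rel eq_sym (eq_sym (odd i)). Qed.
Fact two_triangles_irrefl : irreflexive two_triangles_rel.
Proof. by move=> i; rewrite /two_triangles_rel eqxx. Qed.
Fact hexagon_sym : symmetric hexagon_rel.
Proof. by move=> i j; rewrite /hexagon_rel orbC. Qed.
Fact hexagon_irrefl : irreflexive hexagon_rel.
Proof. by case=> [[|[|[|[|[|[|]]]]]]]. Qed.

Definition two_triangles : sgraph := SGraph two_triangles_sym two_triangles_irrefl.
Definition hexagon : sgraph := SGraph hexagon_sym hexagon_irrefl.

Lemma distance_adjacent (X : sgraph) (u v : X) n :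
  (u == v) || edge u v -> distance u v n <-> n = (u != v).
Proof.
move=> uv; have w : walk u v (u != v).
  case: eqP uv => [-> _|_ /= uv]; first by exists [::].
  by exists [:: v]; rewrite /= uv.
have low m : walk u v m -> (u != v) <= m.
  case: m => [[p [_ pv /eqP/nilP p0]]|m _]; last by case: eqP.
  by rewrite -pv p0 eqxx.
split=> [[wn nmin]|->]; last by split.
by apply/eqP; rewrite eqn_leq nmin // low.
Qed.

Lemma two_triangles_distance_hereditary : distance_hereditary two_triangles.
Proof.
move=> S conn u v n; have /connectP[p up vp] := conn u v.
have uv : odd (val u) = odd (val v).
  rewrite {v}vp; elim: p u up => //= w p IH u /andP[/andP[_ /eqP uw] wp].
  by rewrite (uw : odd (val u) = odd (val w)); apply: IH.
rewrite !distance_adjacent //.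
- by rewrite orbC; rewrite /= /two_triangles_rel uv eqxx andbT orNb.
- by rewrite orbC; rewrite /= /induced_edge /= /two_triangles_rel uv eqxx andbT -val_eqE orNb.
Qed.

Lemma cr_regular (X Y : sgraph) n :
  (forall x : X, size [seq w <- enum X | edge x w] = n) ->
  (forall y : Y, size [seq w <- enum Y | edge y w] = n) ->
  forall r (x : X) (y : Y), cr r x = cr r y.
Proof.
move=> degX degY.
suff mono r : exists c, (forall x : X, cr r x = c) /\ (forall y : Y, cr r y = c).
  by move=> r x y; have [c [-> ->]] := mono r.
elim: r => [|r [c [cX cY]]]; first by exists tt.
have const (Z : sgraph) (z : Z) : (forall z : Z, cr r z = c) ->
    size [seq w <- enum Z | edge z w] = n ->
    cr r.+1 z = (c, seq_mset (nseq n c)).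
  move=> cZ degz /=; rewrite cZ; congr (_, seq_mset _).
  by rewrite (eq_map cZ) -degz; elim: filter => //= a s ->.
by exists (c, seq_mset (nseq n c)); split=> z; apply: const.
Qed.

Lemma degree_I6 (a : rel 'I_6) (p : rel nat) (x : 'I_6) :
  (forall w : 'I_6, a x w = p x w) ->
  size [seq w <- enum 'I_6 | a x w] = count (p x) (iota 0 6).
Proof.
move=> ap; rewrite size_filter -val_enum_ord count_map.
by apply: eq_count => w; rewrite ap.
Qed.

Lemma hexagon_triangle_free (i j k : hexagon) :
  edge i j -> edge j k -> edge k i -> False.
Proof.
by case: i j k => [[|[|[|[|[|[|]]]]]]] // ? [[|[|[|[|[|[|]]]]]]] // ?
  [[|[|[|[|[|[|]]]]]]].
Qed.

(** Colour refinement sees only that both graphs are regular of degree two. *)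
Lemma two_triangles_not_identified : ~ identifies 1 two_triangles.
Proof.
move=> /(_ hexagon)[[f _ fe]|r].
  pose v n (n6 : n < 6) : two_triangles := Ordinal n6.
  by apply: (@hexagon_triangle_free (f (v 0 isT)) (f (v 2 isT)) (f (v 4 isT)));
    rewrite fe.
have same := @cr_regular two_triangles hexagon 2 _ _ r.
apply; congr seq_mset; apply: eq_map => v; apply: same => x.
  rewrite (degree_I6 (p := fun m n => (m != n) && (odd m == odd n))) //.
  by case: x => [[|[|[|[|[|[|]]]]]]].
rewrite (degree_I6 (p := fun m n => (m.+1 == n %[mod 6]) || (n.+1 == m %[mod 6]))) //.
by case: x => [[|[|[|[|[|[|]]]]]]].
Qed.

Theorem theorem1 : class_WL_dimension distance_hereditary 2.
Proof.
have from2 X : distance_hereditary X -> identifies_from X 2.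
  by move=> dh; split=> // d; apply: distance_hereditary_identified.
split=> [X dh|].
  have [id1|nid1] := classic (identifies 1 X).
    exists 1 => //; split; last by move=> m [].
    split=> // -[|[|d]] // _; last exact: distance_hereditary_identified.
  exists 2 => //; split; first exact: from2.
  by case=> [[]//|[|//]] [_ /(_ 1 isT)].
exists two_triangles; first exact: two_triangles_distance_hereditary.
split; first exact/from2/two_triangles_distance_hereditary.
case=> [[]//|[|//]] [_ /(_ 1 isT) id1].
by case: two_triangles_not_identified.
Qed.
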